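(* Let $(M_1,\mathrm{dist}_1)$ and $(M_2,\mathrm{dist}_2)$ be compact metric spaces, $\phi_1$ a topological flow on $M_1$ and $\phi_2$ a topological flow on $M_2$. Suppose $\phi_1$ has the oriented shadowing property and $\mathrm{Sing}(\phi_1)$ is finite. Suppose the limit set $L(\phi_2)$ is a finite set consisting of singularities of $\phi_2$, each of which is Lyapunov stable or Lyapunov unstable. Then the product flow $\phi_1\times\phi_2$ on $M_1\times M_2$, $(\phi_1\times\phi_2)(t,(x_1,x_2))=(\phi_1(t,x_1),\phi_2(t,x_2))$, has the oriented shadowing property (with respect to the metric $\mathrm{dist}((x_1,x_2),(y_1,y_2))=\max\{\mathrm{dist}_1(x_1,y_1),\mathrm{dist}_2(x_2,y_2)\}$).
   Context: A topological flow on a compact metric space $M$ is a continuous map $\phi:\mathbb{R}\times M\to M$ with $\phi(0,x)=x$ and $\phi(s+t,x)=\phi(s,\phi(t,x))$. $\mathrm{Sing}(\phi)=\{x: \phi(t,x)=x\ \forall t\}$. A singularity $p$ is Lyapunov stable if for every neighborhood $V$ of $p$ there is a neighborhood $U$ of $p$ with $\phi(t,x)\in V$ for all $t\ge0$, $x\in U$; Lyapunov unstable if the same holds for $t\le 0$. The limit set $L(\phi)$ is the union over $x\in M$ of the $\omega$-limit and $\alpha$-limit sets of $x$. A $d$-pseudotrajectory is a map $\xi:\mathbb{R}\to M$ with $\mathrm{dist}(\xi(t+s),\phi(s,\xi(t)))<d$ for all $t\in\mathbb{R}$, $s\in[0,1]$. $\mathrm{Rep}$ is the set of orientation-preserving homeomorphisms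 of $\mathbb{R}$. $\phi$ has the oriented shadowing property if for every $\varepsilon>0$ there is $d>0$ such that for every $d$-pseudotrajectory $\xi$ there are $x\in M$ and $h\in\mathrm{Rep}$ with $\mathrm{dist}(\xi(t),\phi(h(t),x))<\varepsilon$ for all $t\in\mathbb{R}$. *)

(* Defs.v *)
From Stdlib Require Import Reals List.
Open Scope R_scope.

Section Defs.
Context {M : Type} (d : M -> M -> R).

Definition is_metric : Prop :=
  (forall x y, 0 <= d x y) /\
  (forall x y, d x y = 0 <-> x = y) /\
  (forall x y, d x y = d y x) /\
  (forall x y z, d x z <= d x y + d y z).

Definition metric_open (U : M -> Prop) : Prop :=
  forall x, U x -> exists r, 0 < r /\ forall y, d x y < r -> U y.

Definition metric_compact : Prop :=
  forall (I : Type) (U : I -> M -> Prop),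
    (forall i, metric_open (U i)) ->
    (forall x, exists i, U i x) ->
    exists l : list I, forall x, exists i, In i l /\ U i x.

Definition is_flow (phi : R -> M -> M) : Prop :=
  (forall x, phi 0 x = x) /\
  (forall s t x, phi (s + t) x = phi s (phi t x)) /\
  (forall t x eps, 0 < eps -> exists del, 0 < del /\
     forall s y, Rabs (s - t) < del -> d x y < del -> d (phi t x) (phi s y) < eps).

Definition singular (phi : R -> M -> M) (p : M) : Prop :=
  forall t, phi t p = p.

Definition finite_set (P : M -> Prop) : Prop :=
  exists l : list M, forall x, P x -> In x l.

Definition lyapunov_stable (phi : R -> M -> M) (p : M) : Prop :=
  forall V : M -> Prop, metric_open V -> V p ->
  exists U : M -> Prop, metric_open U /\ U p /\
    forall t x, 0 <= t -> U x -> V (phi t x).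

Definition lyapunov_unstable (phi : R -> M -> M) (p : M) : Prop :=
  forall V : M -> Prop, metric_open V -> V p ->
  exists U : M -> Prop, metric_open U /\ U p /\
    forall t x, t <= 0 -> U x -> V (phi t x).

Definition omega_limit (phi : R -> M -> M) (x y : M) : Prop :=
  forall T eps, 0 < eps -> exists t, T <= t /\ d (phi t x) y < eps.

Definition alpha_limit (phi : R -> M -> M) (x y : M) : Prop :=
  forall T eps, 0 < eps -> exists t, t <= T /\ d (phi t x) y < eps.

Definition limit_set (phi : R -> M -> M) (y : M) : Prop :=
  exists x, omega_limit phi x y \/ alpha_limit phi x y.

Definition pseudotrajectory (phi : R -> M -> M) (del : R) (xi : R -> M) : Prop :=
  forall t s, 0 <= s <= 1 -> d (xi (t + s)) (phi s (xi t)) < del.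

End Defs.

Definition Rep (h : R -> R) : Prop :=
  (forall s t, s < t -> h s < h t) /\
  (forall y, exists x, h x = y) /\
  (forall t, continuity_pt h t).

Definition oriented_shadowing {M : Type} (d : M -> M -> R) (phi : R -> M -> M) : Prop :=
  forall eps, 0 < eps -> exists del, 0 < del /\
    forall xi : R -> M, pseudotrajectory d phi del xi ->
    exists (x : M) (h : R -> R), Rep h /\
      forall t, d (xi t) (phi (h t) x) < eps.

Definition prod_dist {M1 M2 : Type} (d1 : M1 -> M1 -> R) (d2 : M2 -> M2 -> R)
  (p q : M1 * M2) : R := Rmax (d1 (fst p) (fst q)) (d2 (snd p) (snd q)).

Definition prod_flow {M1 M2 : Type} (phi1 : R -> M1 -> M1) (phi2 : R -> M2 -> M2)
  (t : R) (p : M1 * M2) : M1 * M2 := (phi1 t (fst p), phi2 t (snd p)).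

(* Main.v *)
Require Import Defs.
From Stdlib Require Import Reals List Lra Classical.
Open Scope R_scope.

(** In [M2], a stable (unstable) point of the finite limit set traps nearby
    pseudotrajectories in forward (backward) time, so a pseudotrajectory either stays
    near one singularity forever or passes from an unstable point to a stable one
    during a time window of bounded length [N]; outside that window any
    reparametrization will do.  It remains to shadow in [M1] with a reparametrization
    [h] of almost unit speed on a prescribed window of length [N].  If the
    pseudotrajectory enters the window very close to a singularity, the shadowing orbit
    also stays close to it during the window, and [h] can be replaced there by a map of
    slope one.  Otherwise the orbit stays away from the singularities during the window,
    where short periods are excluded, and this forces [h] itself to have almost unit
    speed. *)

Definition reverse_flow {M : Type} (phi : R -> M -> M) (t : R) (x : M) : M :=
  phi (- t) x.

(** * Finite sets and compactness in metric spaces *)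

Section MetricSpace.
Context {M : Type} (d : M -> M -> R).
Hypothesis dm : is_metric d.

Lemma metric_nonneg (x y : M) : 0 <= d x y.
Proof. apply dm. Qed.

Lemma metric_refl (x : M) : d x x = 0.
Proof. destruct dm as (_ & H & _). now apply H. Qed.

Lemma metric_eq (x y : M) : d x y = 0 -> x = y.
Proof. destruct dm as (_ & H & _). apply H. Qed.

Lemma metric_pos (x y : M) : x <> y -> 0 < d x y.
Proof.
  intros H. destruct (metric_nonneg x y) as [|E]; [assumption|].
  now destruct H; apply metric_eq.
Qed.

Lemma metric_sym (x y : M) : d x y = d y x.
Proof. apply dm. Qed.

Lemma metric_tri (x y z : M) : d x z <= d x y + d y z.
Proof. apply dm. Qed.

Lemma ball_open (x : M) (r : R) : metric_open d (fun y => d x y < r).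
Proof.
  intros y Hy. exists (r - d x y). split; [lra|].
  intros z Hz. pose proof (metric_tri x y z). lra.
Qed.

(** The minimum of finitely many admissible constants works, because [P] passes to smaller
    constants. The enumerating list may contain points outside [S], hence the case distinction in
    the induction. *)
Lemma finite_uniform (P : M -> R -> Prop) (S : M -> Prop) :
  finite_set S ->
  (forall x c c', P x c -> 0 < c' <= c -> P x c') ->
  (forall x, S x -> exists c, 0 < c /\ P x c) ->
  exists c, 0 < c /\ forall x, S x -> P x c.
Proof.
  intros [l Hl] Hmono Hex.
  enough (E : exists c, 0 < c /\ forall x, In x l -> S x -> P x c).
  { destruct E as (c & Hc & H). exists c. auto. }
  clear Hl. induction l as [|a l (c & Hc & IH)].
  - exists 1. split; [lra|]. intros x [].
  - destruct (classic (S a)) as [Sa|Sa].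
    + destruct (Hex a Sa) as (c' & Hc' & Ha).
      assert (0 < Rmin c c') by now apply Rmin_pos.
      pose proof (Rmin_l c c'). pose proof (Rmin_r c c').
      exists (Rmin c c'). split; [assumption|].
      intros x [<-|Hx] Sx; eapply Hmono; eauto.
    + exists c. split; [assumption|]. intros x [<-|Hx] Sx; [contradiction|auto].
Qed.

Lemma finite_separated (S : M -> Prop) :
  finite_set S ->
  exists c, 0 < c /\ forall x y, S x -> S y -> d x y < c -> x = y.
Proof.
  intros HS.
  destruct (finite_uniform (fun x c => forall y, S y -> d x y < c -> x = y) S HS)
    as (c & Hc & H).
  - intros x c c' H [? ?] y Sy Hy. apply H; [assumption|lra].
  - intros x _.
    destruct (finite_uniform (fun y c => d x y < c -> x = y) S HS) as (c & Hc & H).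
    + intros y c c' H [? ?] Hy. apply H. lra.
    + intros y _. destruct (classic (x = y)) as [E|E].
      * exists 1. split; [lra|auto].
      * exists (d x y). split; [now apply metric_pos|]. lra.
    + exists c. auto.
  - exists c. split; [assumption|]. intros x y Sx. now apply H.
Qed.

Hypothesis cpt : metric_compact d.

(** Compactness as an induction principle: a property of subsets that passes to subsets and finite
    unions holds globally once it holds locally. *)
Lemma compact_local_global (P : (M -> Prop) -> Prop) :
  (forall A B : M -> Prop, (forall x, A x -> B x) -> P B -> P A) ->
  P (fun _ => False) ->
  (forall A B, P A -> P B -> P (fun x => A x \/ B x)) ->
  (forall x, exists r, 0 < r /\ P (fun y => d x y < r)) ->
  P (fun _ => True).
Proof.
  intros Hsub H0 HU Hloc.
  (* [U i] is the ball [i] if [P] holds for that ball and is empty otherwise, so a finite subcover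
     effectively uses good balls only. *)
  pose (U := fun (i : (M * R)%type) y => P (fun z => d (fst i) z < snd i) /\ d (fst i) y < snd i).
  destruct (cpt _ U) as [l Hl].
  - intros [x r] y [HP Hy]. destruct (ball_open x r y Hy) as (e & He & H).
    exists e. split; [assumption|]. intros z Hz. split; [exact HP|]. now apply H.
  - intros x. destruct (Hloc x) as (r & Hr & HP). exists (x, r).
    split; [exact HP|]. cbn. rewrite metric_refl. exact Hr.
  - apply (Hsub _ (fun x => exists i, In i l /\ U i x)); [auto|].
    clear Hl. induction l as [|i l IH].
    + apply (Hsub _ (fun _ => False)); [|assumption]. intros x (i & [] & _).
    + apply (Hsub _ (fun x => U i x \/ exists j, In j l /\ U j x)).
      * intros x (j & [<-|Hj] & Hx); [now left|right; eauto].
      * apply HU; [|assumption].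
        destruct (classic (P (fun z => d (fst i) z < snd i))) as [HP|HP].
        -- eapply Hsub; [|exact HP]. now intros x [_ Hx].
        -- eapply Hsub; [|exact H0]. now intros x [HP' _].
Qed.

Lemma compact_uniform_radius (Q : M -> R -> Prop) :
  (forall x c c', Q x c -> 0 < c' <= c -> Q x c') ->
  (forall x, exists r c, 0 < r /\ 0 < c /\ forall y, d x y < r -> Q y c) ->
  exists c, 0 < c /\ forall x, Q x c.
Proof.
  intros Hmono Hloc.
  destruct (compact_local_global (fun A => exists c, 0 < c /\ forall x, A x -> Q x c))
    as (c & Hc & H).
  - intros A B HAB (c & Hc & H). exists c. auto.
  - exists 1. split; [lra|]. intros x [].
  - intros A B (a & Ha & HA) (b & Hb & HB).
    assert (0 < Rmin a b) by now apply Rmin_pos.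
    pose proof (Rmin_l a b). pose proof (Rmin_r a b).
    exists (Rmin a b). split; [assumption|].
    intros x [Ax|Bx]; eapply Hmono; eauto.
  - intros x. destruct (Hloc x) as (r & c & Hr & Hc & H). exists r. split; eauto.
  - exists c. auto.
Qed.

Lemma compact_uniform_time (Q : M -> R -> Prop) :
  (forall x T T', Q x T -> T <= T' -> Q x T') ->
  (forall x, exists r T, 0 < r /\ forall y, d x y < r -> Q y T) ->
  exists T, 0 <= T /\ forall x, Q x T.
Proof.
  intros Hmono Hloc.
  destruct (compact_local_global (fun A => exists T, 0 <= T /\ forall x, A x -> Q x T))
    as (T & HT & H).
  - intros A B HAB (T & HT & H). exists T. auto.
  - exists 0. split; [lra|]. intros x [].
  - intros A B (a & Ha & HA) (b & Hb & HB).
    pose proof (Rmax_l a b). pose proof (Rmax_r a b).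
    exists (Rmax a b). split; [lra|].
    intros x [Ax|Bx]; eapply Hmono; eauto.
  - intros x. destruct (Hloc x) as (r & T & Hr & H). exists r. split; [assumption|].
    pose proof (Rmax_l T 0). pose proof (Rmax_r T 0).
    exists (Rmax T 0). split; [assumption|]. intros y Hy. eapply Hmono; eauto.
  - exists T. auto.
Qed.

End MetricSpace.

(** * Uniform estimates for flows and pseudotrajectories on a compact space *)

Section Flow.
Context {M : Type} (d : M -> M -> R) (phi : R -> M -> M).
Hypothesis dm : is_metric d.
Hypothesis cpt : metric_compact d.
Hypothesis fl : is_flow d phi.

Lemma flow_zero (x : M) : phi 0 x = x.
Proof. apply fl. Qed.

Lemma flow_add (s t : R) (x : M) : phi s (phi t x) = phi (s + t) x.
Proof. symmetry. apply fl. Qed.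

Lemma flow_continuous (t : R) (x : M) (eps : R) : 0 < eps ->
  exists r, 0 < r /\ forall y, d x y < r -> d (phi t x) (phi t y) < eps.
Proof.
  intros He. destruct fl as (_ & _ & H).
  destruct (H t x eps He) as (r & Hr & Hc). exists r. split; [assumption|].
  intros y Hy. apply Hc; [|assumption].
  now replace (t - t) with 0 by ring; rewrite Rabs_R0.
Qed.

Lemma reverse_is_flow : is_flow d (reverse_flow phi).
Proof.
  destruct fl as (H0 & Hadd & Hc). unfold reverse_flow. split; [|split].
  - intros x. now rewrite Ropp_0.
  - intros s t x. now rewrite Ropp_plus_distr, Hadd.
  - intros t x eps He. destruct (Hc (- t) x eps He) as (r & Hr & H).
    exists r. split; [assumption|]. intros s y Hs Hy. apply H; [|assumption].
    now replace (- s - - t) with (- (s - t)) by ring; rewrite Rabs_Ropp.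
Qed.

Lemma small_time (eps : R) : 0 < eps ->
  exists tau, 0 < tau /\ forall t x, Rabs t <= tau -> d x (phi t x) < eps.
Proof.
  intros He.
  destruct (compact_uniform_radius d dm cpt
    (fun x c => forall t, Rabs t <= c -> d x (phi t x) < eps)) as (c & Hc & H).
  - intros x c c' H [? ?] t Ht. apply H. lra.
  - intros x. destruct fl as (H0 & _ & Hc).
    destruct (Hc 0 x (eps / 2)) as (r & Hr & H); [lra|]. rewrite H0 in H.
    exists (Rmin r (eps / 2)), (r / 2).
    assert (0 < Rmin r (eps / 2)) by (apply Rmin_pos; lra).
    pose proof (Rmin_l r (eps / 2)). pose proof (Rmin_r r (eps / 2)).
    split; [assumption|]. split; [lra|]. intros y Hy t Ht.
    assert (d x (phi t y) < eps / 2) by (apply H; rewrite ?Rminus_0_r; lra).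
    pose proof (metric_tri d dm y x (phi t y)). pose proof (metric_sym d dm x y). lra.
  - exists c. auto.
Qed.

Lemma flow_equicontinuous_at (t eps : R) : 0 < eps ->
  exists c, 0 < c /\ forall x y, d x y < c -> d (phi t x) (phi t y) < eps.
Proof.
  intros He.
  destruct (compact_uniform_radius d dm cpt
    (fun x c => forall y, d x y < c -> d (phi t x) (phi t y) < eps)) as (c & Hc & H).
  - intros x c c' H [? ?] y Hy. apply H. lra.
  - intros x. destruct (flow_continuous t x (eps / 2)) as (r & Hr & H); [lra|].
    exists (r / 2), (r / 2). split; [lra|]. split; [lra|].
    intros y Hy z Hz. pose proof (metric_tri d dm x y z).
    assert (d (phi t x) (phi t y) < eps / 2) by (apply H; lra).
    assert (d (phi t x) (phi t z) < eps / 2) by (apply H; lra).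
    pose proof (metric_tri d dm (phi t y) (phi t x) (phi t z)).
    pose proof (metric_sym d dm (phi t x) (phi t y)). lra.
  - exists c. auto.
Qed.

(** Cut [[0, T]] into steps of length [tau], during which every point moves less than [eps / 3]. It
    then suffices to control the finitely many maps [phi (INR n * tau)]. *)
Lemma flow_equicontinuous (T eps : R) : 0 < eps ->
  exists c, 0 < c /\
    forall t x y, 0 <= t <= T -> d x y < c -> d (phi t x) (phi t y) < eps.
Proof.
  intros He. destruct (small_time (eps / 3)) as (tau & Htau & Hs); [lra|].
  assert (E : forall n, exists c, 0 < c /\ forall t x y, 0 <= t <= INR n * tau ->
    d x y < c -> d (phi t x) (phi t y) < eps).
  { induction n as [|n (c & Hc & IH)].
    - exists eps. split; [assumption|]. intros t x y Ht Hxy. cbn in Ht.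
      replace t with 0 by lra. now rewrite !flow_zero.
    - destruct (flow_equicontinuous_at (INR n * tau) (eps / 3)) as (c' & Hc' & H); [lra|].
      assert (0 < Rmin c c') by now apply Rmin_pos.
      pose proof (Rmin_l c c'). pose proof (Rmin_r c c').
      exists (Rmin c c'). split; [assumption|]. intros t x y Ht Hxy.
      destruct (Rle_dec t (INR n * tau)) as [L|L]; [apply IH; lra|].
      rewrite S_INR in Ht. set (s := t - INR n * tau).
      replace t with (s + INR n * tau) by (unfold s; ring). rewrite <- !flow_add.
      assert (As : Rabs s <= tau) by (apply Rabs_le; unfold s; lra).
      pose proof (Hs s (phi (INR n * tau) x) As) as Sx.
      pose proof (Hs s (phi (INR n * tau) y) As) as Sy.
      assert (Fxy := H x y ltac:(lra)).
      set (a := phi (INR n * tau) x) in *. set (b := phi (INR n * tau) y) in *.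
      pose proof (metric_tri d dm (phi s a) a (phi s b)).
      pose proof (metric_tri d dm a b (phi s b)).
      pose proof (metric_sym d dm a (phi s a)). lra. }
  destruct (INR_unbounded (T / tau)) as [n Hn].
  destruct (E n) as (c & Hc & H). exists c. split; [assumption|].
  intros t x y Ht. apply H. split; [lra|].
  assert (T / tau * tau < INR n * tau) by now apply Rmult_lt_compat_r.
  unfold Rdiv in *. rewrite Rmult_assoc, Rinv_l in * by lra. lra.
Qed.

Lemma pseudotrajectory_weaken (c c' : R) (xi : R -> M) :
  c <= c' -> pseudotrajectory d phi c xi -> pseudotrajectory d phi c' xi.
Proof. intros Hc H t s Hs. specialize (H t s Hs). lra. Qed.

Lemma orbit_pseudotrajectory (c : R) (x : M) : 0 < c ->
  pseudotrajectory d phi c (fun t => phi t x).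
Proof.
  intros Hc t s _. rewrite flow_add, Rplus_comm, (metric_refl d dm). exact Hc.
Qed.

(** Induction on the number of unit time steps: equicontinuity over one unit turns the error
    accumulated so far into at most [eps / 2], and the last step adds at most [eps / 2]. *)
Lemma pseudotrajectory_tracks (T eps : R) : 0 < eps ->
  exists c, 0 < c /\ forall xi, pseudotrajectory d phi c xi ->
    forall t s, 0 <= s <= T -> d (xi (t + s)) (phi s (xi t)) < eps.
Proof.
  intros He0.
  enough (E : forall n eps, 0 < eps ->
    exists c, 0 < c /\ forall xi, pseudotrajectory d phi c xi ->
      forall t s, 0 <= s <= INR n -> d (xi (t + s)) (phi s (xi t)) < eps).
  { destruct (INR_unbounded T) as [n Hn].
    destruct (E n eps He0) as (c & Hc & H). exists c. split; [assumption|].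
    intros xi Hxi t s Hs. apply H; [assumption|lra]. }
  clear T eps He0. induction n as [|n IH]; intros eps He.
  - exists 1. split; [lra|]. intros xi _ t s Hs. cbn in Hs.
    replace s with 0 by lra. now rewrite Rplus_0_r, flow_zero, (metric_refl d dm).
  - destruct (flow_equicontinuous 1 (eps / 2)) as (a & Ha & Heq); [lra|].
    assert (0 < Rmin a eps) by now apply Rmin_pos.
    pose proof (Rmin_l a eps). pose proof (Rmin_r a eps).
    destruct (IH (Rmin a eps)) as (b & Hb & Htr); [assumption|].
    assert (0 < Rmin b (eps / 2)) by (apply Rmin_pos; lra).
    pose proof (Rmin_l b (eps / 2)). pose proof (Rmin_r b (eps / 2)).
    exists (Rmin b (eps / 2)). split; [assumption|]. intros xi Hxi t s Hs.
    pose proof (pseudotrajectory_weaken _ b xi (Rmin_l b (eps / 2)) Hxi) as Hxi'.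
    rewrite S_INR in Hs. pose proof (pos_INR n).
    destruct (Rle_dec s (INR n)) as [L|L].
    + specialize (Htr xi Hxi' t s). lra.
    + set (u := s - INR n). assert (Hu : 0 <= u <= 1) by (unfold u; lra).
      specialize (Htr xi Hxi' t (INR n) ltac:(lra)).
      pose proof (Hxi (t + INR n) u Hu) as Step.
      pose proof (Heq u _ _ Hu (Rlt_le_trans _ _ _ Htr (Rmin_l a eps))) as Prev.
      rewrite flow_add in Prev. replace (t + INR n + u) with (t + s) in Step by (unfold u; ring).
      replace (u + INR n) with s in Prev by (unfold u; ring).
      pose proof (metric_tri d dm (xi (t + s)) (phi u (xi (t + INR n))) (phi s (xi t))). lra.
Qed.

(** Otherwise every point has a neighbourhood that the orbit finally leaves; by compactness a single
    [T] serves all points, including [phi T x] itself. *)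
Lemma omega_limit_nonempty (x : M) : exists y, omega_limit d phi x y.
Proof.
  apply NNPP. intros Hno.
  destruct (compact_uniform_time d dm cpt (fun y T => forall t, T <= t -> phi t x <> y))
    as (T & _ & H).
  - intros y T T' H HT t Ht. apply H. lra.
  - intros y. apply NNPP. intros Hn. apply Hno. exists y. intros T eps He.
    apply NNPP. intros Hfar. apply Hn. exists eps, T. split; [assumption|].
    intros z Hz t Ht <-. apply Hfar. exists t. split; [assumption|].
    now rewrite (metric_sym d dm).
  - exact (H (phi T x) T (Rle_refl T) eq_refl).
Qed.

End Flow.

(** * Time reversal *)

Section Reversal.
Context {M : Type} (d : M -> M -> R) (phi : R -> M -> M).
Hypothesis dm : is_metric d.
Hypothesis cpt : metric_compact d.
Hypothesis fl : is_flow d phi.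

(** Apply [phi (- s)] to the defining inequality at time [- (t + s)]; equicontinuity of the reversed
    flow over unit time bounds the resulting loss in the constant. *)
Lemma reverse_pseudotrajectory (c : R) : 0 < c ->
  exists c', 0 < c' /\ forall xi, pseudotrajectory d phi c' xi ->
    pseudotrajectory d (reverse_flow phi) c (fun t => xi (- t)).
Proof.
  intros Hc.
  destruct (flow_equicontinuous d (reverse_flow phi) dm cpt (reverse_is_flow d phi fl)
    1 c Hc) as (c' & Hc' & H).
  exists c'. split; [assumption|]. intros xi Hxi t s Hs.
  specialize (Hxi (- (t + s)) s Hs). specialize (H s _ _ Hs Hxi).
  replace (- (t + s) + s) with (- t) in H by ring. unfold reverse_flow in *.
  rewrite (flow_add d phi fl) in H. replace (- s + s) with 0 in H by ring.
  now rewrite (flow_zero d phi fl), (metric_sym d dm) in H.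
Qed.

Lemma reverse_limit_set (y : M) :
  limit_set d (reverse_flow phi) y <-> limit_set d phi y.
Proof.
  split; intros [x [H|H]]; exists x; [right|left|right|left]; intros T eps He;
    destruct (H (- T) eps He) as (t & Ht & Hd); exists (- t);
    (split; [lra|]); unfold reverse_flow in *; now rewrite ?Ropp_involutive.
Qed.

Lemma reverse_unstable (p : M) :
  lyapunov_unstable d phi p -> lyapunov_stable d (reverse_flow phi) p.
Proof.
  intros H V HV Vp. destruct (H V HV Vp) as (U & HU & Up & Hin).
  exists U. split; [assumption|]. split; [assumption|].
  intros t x Ht. apply Hin. lra.
Qed.

End Reversal.

(** * Trapping of pseudotrajectories near stable limit points *)

Lemma stable_ball {M : Type} (d : M -> M -> R) (phi : R -> M -> M) (p : M) (eps : R) :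
  is_metric d -> lyapunov_stable d phi p -> 0 < eps ->
  exists r, 0 < r /\ forall t x, 0 <= t -> d p x < r -> d p (phi t x) < eps.
Proof.
  intros dm Hp He.
  destruct (Hp (fun y => d p y < eps)) as (U & HU & Up & H).
  - now apply ball_open.
  - now rewrite (metric_refl d dm).
  - destruct (HU p Up) as (r & Hr & Hball). exists r. auto.
Qed.

Section Trapping.
Context {M : Type} (d : M -> M -> R) (phi : R -> M -> M).
Hypothesis dm : is_metric d.
Hypothesis cpt : metric_compact d.
Hypothesis fl : is_flow d phi.
Hypothesis finite_limit : finite_set (limit_set d phi).

(* A stable point that is isolated in the limit set attracts a neighbourhood,
   uniformly on compact balls: a ball is mapped well inside itself after a fixed
   time, so that the errors of a pseudotrajectory do not accumulate. *)
Lemma stable_traps (p : M) (eps : R) :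
  limit_set d phi p -> lyapunov_stable d phi p -> 0 < eps ->
  exists c, 0 < c /\ forall xi, pseudotrajectory d phi c xi ->
    forall t0 t, d p (xi t0) < c -> t0 <= t -> d p (xi t) < eps.
Proof.
  intros Lp Hp He.
  destruct (finite_separated d dm _ finite_limit) as (c0 & Hc0 & Hsep).
  (* [eps / 2] leaves room for the tracking error. [c0 / 2] isolates [p]: an orbit that stays within
     [e0] of [p] has no other omega-limit point. *)
  set (e0 := Rmin (eps / 2) (c0 / 2)).
  assert (He0 : 0 < e0) by (apply Rmin_pos; lra).
  assert (e0 <= eps / 2) by apply Rmin_l. assert (e0 <= c0 / 2) by apply Rmin_r.
  destruct (stable_ball d phi p e0 dm Hp He0) as (r0 & Hr0 & Hin0).
  destruct (stable_ball d phi p (r0 / 4) dm Hp ltac:(lra)) as (r1 & Hr1 & Hin1).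
  assert (Hattr : forall x, d p x < r0 -> exists t, 0 <= t /\ d p (phi t x) < r1).
  { intros x Hx. destruct (omega_limit_nonempty d phi dm cpt x) as [y Hy].
    assert (E : p = y).
    { apply Hsep; [assumption|exists x; now left|].
      destruct (Hy 0 (c0 / 2) ltac:(lra)) as (t & Ht & Hd).
      specialize (Hin0 t x Ht Hx). pose proof (metric_tri d dm p (phi t x) y). lra. }
    subst y. destruct (Hy 0 r1 Hr1) as (t & Ht & Hd). exists t.
    now rewrite (metric_sym d dm). }
  (* Attraction is known on the [r0]-ball and wanted on the half ball, so that points outside the
     [r0]-ball have neighbourhoods where the claim is vacuous. *)
  destruct (compact_uniform_time d dm cpt (fun x T => d p x <= r0 / 2 ->
    exists t, 0 <= t <= T /\ d p (phi t x) < r1)) as (T & HT & Htime).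
  { intros x T T' HQ HT Hx. destruct (HQ Hx) as (t & Ht & Hd). exists t. split; [lra|auto]. }
  { intros x. destruct (Rlt_dec (d p x) r0) as [Hx|Hx].
    - destruct (Hattr x Hx) as (t & Ht & Hd).
      destruct (flow_continuous d phi fl t x (r1 - d p (phi t x))) as (r & Hr & H'); [lra|].
      exists r, t. split; [assumption|]. intros y Hy _. exists t. split; [lra|].
      specialize (H' y Hy). pose proof (metric_tri d dm p (phi t x) (phi t y)). lra.
    - exists (r0 / 2), 0. split; [lra|]. intros y Hy Hy'.
      pose proof (metric_tri d dm p y x). rewrite (metric_sym d dm) in Hy. lra. }
  (* Once in the [r1]-ball, an orbit never leaves the [r0 / 4]-ball again. The return time is
     [T + 1] because [T] may be zero and the period of the iteration below must be positive. *)
  assert (Hret : forall x, d p x < r0 / 2 -> d p (phi (T + 1) x) < r0 / 4).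
  { intros x Hx. destruct (Htime x ltac:(lra)) as (t & Ht & Hd).
    replace (T + 1) with ((T + 1 - t) + t) by ring. rewrite <- (flow_add d phi fl).
    apply Hin1; [lra|assumption]. }
  (* With tracking error [r0 / 4] the pseudotrajectory is back in the [r0 / 2]-ball after time
     [T + 1]; with error [eps / 2] it stays [eps]-close in between. *)
  assert (Hk : 0 < Rmin (r0 / 4) (eps / 2)) by (apply Rmin_pos; lra).
  pose proof (Rmin_l (r0 / 4) (eps / 2)). pose proof (Rmin_r (r0 / 4) (eps / 2)).
  destruct (pseudotrajectory_tracks d phi dm cpt fl (T + 1) _ Hk) as (c1 & Hc1 & Htr).
  exists (Rmin c1 (r0 / 2)). split; [apply Rmin_pos; lra|]. intros xi Hxi t0 t Ht0.
  pose proof (Rmin_r c1 (r0 / 2)).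
  specialize (Htr xi (pseudotrajectory_weaken d phi _ _ xi (Rmin_l _ _) Hxi)).
  assert (Hshort : forall a s, d p (xi a) < r0 / 2 -> 0 <= s <= T + 1 ->
    d p (xi (a + s)) < eps).
  { intros a s Ha Hs. specialize (Htr a s Hs). specialize (Hin0 s (xi a) ltac:(lra) ltac:(lra)).
    pose proof (metric_tri d dm p (phi s (xi a)) (xi (a + s))) as Htri.
    rewrite (metric_sym d dm (xi (a + s))) in Htr. lra. }
  assert (Hlong : forall n a s, d p (xi a) < r0 / 2 -> 0 <= s <= INR n * (T + 1) ->
    d p (xi (a + s)) < eps).
  { induction n as [|n IH]; intros a s Ha Hs.
    - apply Hshort; [assumption|]. cbn in Hs. lra.
    - rewrite S_INR in Hs. destruct (Rle_dec s (T + 1)) as [L|L]; [apply Hshort; auto; lra|].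
      replace (a + s) with ((a + (T + 1)) + (s - (T + 1))) by ring.
      apply IH; [|lra]. specialize (Hret _ Ha). specialize (Htr a (T + 1) ltac:(lra)).
      pose proof (metric_tri d dm p (phi (T + 1) (xi a)) (xi (a + (T + 1)))) as Htri.
      rewrite (metric_sym d dm (xi (a + (T + 1)))) in Htr. lra. }
  intros Ht. replace t with (t0 + (t - t0)) by ring.
  destruct (INR_unbounded ((t - t0) / (T + 1))) as [n Hn].
  apply (Hlong n); [lra|]. split; [lra|].
  apply (Rmult_lt_compat_r (T + 1)) in Hn; [|lra].
  unfold Rdiv in Hn. rewrite Rmult_assoc, Rinv_l in Hn by lra. lra.
Qed.

(** The orbit comes arbitrarily close to [q] at some time [t >= 0]; flowing back by [t] cannot leave
    a prescribed neighbourhood of [q], yet it ends at [x]. *)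
Lemma unstable_limit_constant (q x : M) :
  lyapunov_unstable d phi q -> omega_limit d phi x q -> x = q.
Proof.
  intros Hq Hx. symmetry. apply (metric_eq d dm).
  destruct (metric_nonneg d dm q x) as [Hpos|]; [|auto].
  destruct (stable_ball d _ q (d q x) dm (reverse_unstable d phi q Hq) Hpos)
    as (r & Hr & H).
  destruct (Hx 0 r Hr) as (t & Ht & Hd). rewrite (metric_sym d dm) in Hd.
  specialize (H t _ Ht Hd). unfold reverse_flow in H.
  rewrite (flow_add d phi fl), Rplus_opp_l, (flow_zero d phi fl) in H. lra.
Qed.

Hypothesis limit_dichotomy : forall p, limit_set d phi p ->
  lyapunov_stable d phi p \/ lyapunov_unstable d phi p.

(** Take an omega-limit point [p] of [x]. If [p] is unstable then [x = p], and the claim is vacuous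
    on the [ru]-ball around [x]. Otherwise [p] is stable, and coming [rs]-close to it at a fixed
    time is an open condition; compactness makes the time uniform. *)
Lemma reaches_stable (ru rs : R) : 0 < ru -> 0 < rs ->
  exists T, 0 <= T /\ forall x,
    (forall q, limit_set d phi q -> lyapunov_unstable d phi q -> ru <= d q x) ->
    exists p t, limit_set d phi p /\ lyapunov_stable d phi p /\
      0 <= t <= T /\ d p (phi t x) < rs.
Proof.
  intros Hru Hrs. apply (compact_uniform_time d dm cpt (fun x T =>
    (forall q, limit_set d phi q -> lyapunov_unstable d phi q -> ru <= d q x) ->
    exists p t, limit_set d phi p /\ lyapunov_stable d phi p /\
      0 <= t <= T /\ d p (phi t x) < rs)).
  - intros x T T' H HT Hx. destruct (H Hx) as (p & t & Lp & Hp & Ht & Hd).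
    exists p, t. repeat split; try assumption; lra.
  - intros x. destruct (omega_limit_nonempty d phi dm cpt x) as [p Hp].
    assert (Lp : limit_set d phi p) by (exists x; now left).
    destruct (classic (lyapunov_unstable d phi p)) as [Up|Up].
    + pose proof (unstable_limit_constant p x Up Hp) as ->.
      exists ru, 0. split; [assumption|]. intros y Hy Hfar.
      specialize (Hfar p Lp Up). lra.
    + destruct (limit_dichotomy p Lp) as [Sp|]; [|contradiction].
      destruct (Hp 0 rs Hrs) as (t & Ht & Hd). rewrite (metric_sym d dm) in Hd.
      destruct (flow_continuous d phi fl t x (rs - d p (phi t x))) as (r & Hr & H'); [lra|].
      exists r, t. split; [assumption|]. intros y Hy _. exists p, t.
      specialize (H' y Hy). pose proof (metric_tri d dm p (phi t x) (phi t y)).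
      repeat split; try assumption; lra.
Qed.

End Trapping.

(** * Passage of pseudotrajectories from unstable to stable limit points *)

Section Transition.
Context {M : Type} (d : M -> M -> R) (phi : R -> M -> M).
Hypothesis dm : is_metric d.
Hypothesis cpt : metric_compact d.
Hypothesis fl : is_flow d phi.
Hypothesis finite_limit : finite_set (limit_set d phi).

(** This is [stable_traps] for the reversed flow, applied to [fun t => xi (- t)]. *)
Lemma unstable_traps (q : M) (eps : R) :
  limit_set d phi q -> lyapunov_unstable d phi q -> 0 < eps ->
  exists c, 0 < c /\ forall xi, pseudotrajectory d phi c xi ->
    forall t0 t, d q (xi t0) < c -> t <= t0 -> d q (xi t) < eps.
Proof.
  intros Lq Hq He.
  destruct (stable_traps d (reverse_flow phi) dm cpt (reverse_is_flow d phi fl)) with q eps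
    as (c & Hc & H).
  - destruct finite_limit as [l Hl]. exists l. intros x Hx.
    now apply Hl, reverse_limit_set.
  - now apply reverse_limit_set.
  - now apply reverse_unstable.
  - assumption.
  - destruct (reverse_pseudotrajectory d phi dm cpt fl c Hc) as (c' & Hc' & Hrev).
    exists (Rmin c c'). split; [now apply Rmin_pos|]. intros xi Hxi t0 t Ht0 Ht.
    pose proof (pseudotrajectory_weaken d phi _ _ xi (Rmin_r _ _) Hxi) as Hxi'.
    pose proof (Rmin_l c c').
    specialize (H _ (Hrev xi Hxi') (- t0) (- t)). cbv beta in H.
    rewrite !Ropp_involutive in H. apply H; lra.
Qed.

Hypothesis limit_dichotomy : forall p, limit_set d phi p ->
  lyapunov_stable d phi p \/ lyapunov_unstable d phi p.

Lemma limit_set_traps (eps : R) : 0 < eps ->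
  exists c, 0 < c /\ forall p, limit_set d phi p ->
    forall xi, pseudotrajectory d phi c xi -> forall t0, d p (xi t0) < c ->
    (lyapunov_stable d phi p -> forall t, t0 <= t -> d p (xi t) < eps) /\
    (lyapunov_unstable d phi p -> forall t, t <= t0 -> d p (xi t) < eps).
Proof.
  intros He.
  apply (finite_uniform (fun p c =>
    forall xi, pseudotrajectory d phi c xi -> forall t0, d p (xi t0) < c ->
    (lyapunov_stable d phi p -> forall t, t0 <= t -> d p (xi t) < eps) /\
    (lyapunov_unstable d phi p -> forall t, t <= t0 -> d p (xi t) < eps)) _ finite_limit).
  - intros p c c' H [? ?] xi Hxi t0 Ht0. apply H; [|lra].
    now apply (pseudotrajectory_weaken d phi c').
  - intros p Lp.
    assert (Hs : exists c, 0 < c /\ (lyapunov_stable d phi p ->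
      forall xi, pseudotrajectory d phi c xi ->
        forall t0 t, d p (xi t0) < c -> t0 <= t -> d p (xi t) < eps)).
    { destruct (classic (lyapunov_stable d phi p)) as [Sp|Sp].
      - destruct (stable_traps d phi dm cpt fl finite_limit p eps Lp Sp He) as (c & Hc & H).
        eauto.
      - exists 1. split; [lra|contradiction]. }
    assert (Hu : exists c, 0 < c /\ (lyapunov_unstable d phi p ->
      forall xi, pseudotrajectory d phi c xi ->
        forall t0 t, d p (xi t0) < c -> t <= t0 -> d p (xi t) < eps)).
    { destruct (classic (lyapunov_unstable d phi p)) as [Up|Up].
      - destruct (unstable_traps p eps Lp Up He) as (c & Hc & H). eauto.
      - exists 1. split; [lra|contradiction]. }
    destruct Hs as (a & Ha & Hs), Hu as (b & Hb & Hu).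
    pose proof (Rmin_l a b). pose proof (Rmin_r a b).
    exists (Rmin a b). split; [now apply Rmin_pos|]. intros xi Hxi t0 Ht0. split.
    + intros Sp t Ht. apply (Hs Sp xi) with t0; [|lra|assumption].
      now apply (pseudotrajectory_weaken d phi (Rmin a b)).
    + intros Up t Ht. apply (Hu Up xi) with t0; [|lra|assumption].
      now apply (pseudotrajectory_weaken d phi (Rmin a b)).
Qed.

(** Besides [xi], the second alternative controls the exact orbit of [xi T0], which will serve as
    the shadowing orbit. The bound [N - 1] for that orbit leaves a margin of one time unit for the
    drift of a reparametrization over the window. *)
Lemma pseudotrajectory_connects (eps : R) : 0 < eps ->
  exists c N, 0 < c /\ 0 < N /\ forall xi, pseudotrajectory d phi c xi ->
    (exists p, limit_set d phi p /\ forall t, d p (xi t) < eps) \/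
    (exists q p T0,
      (forall t, t <= T0 -> d q (xi t) < eps) /\
      (forall t, T0 + N <= t -> d p (xi t) < eps) /\
      (forall s, s <= 0 -> d q (phi s (xi T0)) < eps) /\
      (forall s, N - 1 <= s -> d p (phi s (xi T0)) < eps) /\
      (forall s, 0 <= s <= N -> d (xi (T0 + s)) (phi s (xi T0)) < eps)).
Proof.
  intros He.
  destruct (finite_separated d dm _ finite_limit) as (c0 & Hc0 & Hsep).
  set (e := Rmin eps (c0 / 2)). assert (He' : 0 < e) by (apply Rmin_pos; lra).
  assert (e <= eps) by apply Rmin_l. assert (e <= c0 / 2) by apply Rmin_r.
  assert (Hsame : forall p q x, limit_set d phi p -> limit_set d phi q ->
    d p x < e -> d q x < e -> p = q).
  { intros p q x Lp Lq Hp Hq. apply Hsep; try assumption.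
    pose proof (metric_tri d dm p x q). pose proof (metric_sym d dm q x). lra. }
  destruct (limit_set_traps e He') as (r & Hr & Htrap).
  destruct (reaches_stable d phi dm cpt fl limit_dichotomy r (r / 4)) as (T & HT & Hreach);
    [lra|lra|].
  assert (Hk : 0 < Rmin (r / 4) e) by (apply Rmin_pos; lra).
  pose proof (Rmin_l (r / 4) e). pose proof (Rmin_r (r / 4) e).
  destruct (pseudotrajectory_tracks d phi dm cpt fl (T + 2) _ Hk) as (c1 & Hc1 & Htr).
  (* The window length [T + 2] allows one unit to leave the unstable point, [T] to reach a stable
     one, and one unit of margin. *)
  exists (Rmin r c1), (T + 2). split; [now apply Rmin_pos|]. split; [lra|]. intros xi Hxi0.
  specialize (Htr xi (pseudotrajectory_weaken d phi _ _ xi (Rmin_r _ _) Hxi0)).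
  pose proof (pseudotrajectory_weaken d phi _ _ xi (Rmin_l _ _) Hxi0) as Hxi.
  clear Hxi0.
  pose (E t := exists q, limit_set d phi q /\ lyapunov_unstable d phi q /\ d q (xi t) < r).
  (* The radius [r / 2], rather than [r], leaves room to pass from [xi] to the exact orbit of
     [xi T0] later on. *)
  assert (Hstep : forall t0, ~ E t0 -> exists p t, limit_set d phi p /\
    lyapunov_stable d phi p /\ 0 <= t <= T /\ d p (xi (t0 + t)) < r / 2).
  { intros t0 Ht0. destruct (Hreach (xi t0)) as (p & t & Lp & Sp & Ht & Hd).
    - intros q Lq Uq. apply Rnot_lt_le. intros Hq. apply Ht0. now exists q.
    - exists p, t. repeat split; try assumption; try lra.
      specialize (Htr t0 t ltac:(lra)). rewrite (metric_sym d dm) in Htr.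
      pose proof (metric_tri d dm p (phi t (xi t0)) (xi (t0 + t))). lra. }
  destruct (classic (exists t, E t)) as [[t1 Ht1]|Hno].
  - destruct (classic (forall t, E t -> E (t + 1))) as [Hall|Hexit].
    (* [xi] is near unstable points at arbitrarily late times, and each of them traps the whole
       past. All these points coincide, since they are all near [xi t1]. *)
    + left. assert (Hn : forall n, E (t1 + INR n)).
      { induction n as [|n IH]; [now cbn; rewrite Rplus_0_r|].
        rewrite S_INR, <- Rplus_assoc. now apply Hall. }
      destruct Ht1 as (q & Lq & Uq & Hq). exists q. split; [assumption|]. intros t.
      destruct (INR_unbounded (t - t1)) as [n Hgt].
      destruct (Hn n) as (q' & Lq' & Uq' & Hq').
      destruct (Htrap q Lq xi Hxi _ Hq) as [_ Hback].
      destruct (Htrap q' Lq' xi Hxi _ Hq') as [_ Hback']. pose proof (pos_INR n).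
      assert (q = q') as <-.
      { apply (Hsame _ _ (xi t1)); [assumption|assumption|apply Hback|apply Hback'];
          try assumption; lra. }
      enough (d q (xi t) < e) by lra. apply Hback'; [assumption|lra].
    + right. apply not_all_ex_not in Hexit. destruct Hexit as [T0 Hexit].
      apply imply_to_and in Hexit. destruct Hexit as [(q & Lq & Uq & Hq) Hout].
      destruct (Hstep _ Hout) as (p & t & Lp & Sp & Ht & Hp).
      (* An exact orbit is a pseudotrajectory, so the same trapping constants apply to it. *)
      assert (Horb : pseudotrajectory d phi r (fun s => phi s (xi T0)))
        by now apply orbit_pseudotrajectory.
      exists q, p, T0. split; [|split; [|split; [|split]]].
      * intros s Hs. destruct (Htrap q Lq xi Hxi _ Hq) as [_ H'].
        specialize (H' Uq s Hs). lra.
      * intros s Hs. destruct (Htrap p Lp xi Hxi (T0 + 1 + t) ltac:(lra)) as [H' _].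
        specialize (H' Sp s ltac:(lra)). lra.
      * intros s Hs. destruct (Htrap q Lq _ Horb 0) as [_ H'].
        { now rewrite (flow_zero d phi fl). }
        specialize (H' Uq s Hs). cbv beta in H'. lra.
      * intros s Hs. destruct (Htrap p Lp _ Horb (1 + t)) as [H' _].
        { specialize (Htr T0 (1 + t) ltac:(lra)). rewrite <- Rplus_assoc in Htr.
          pose proof (metric_tri d dm p (xi (T0 + 1 + t)) (phi (1 + t) (xi T0))). lra. }
        specialize (H' Sp s ltac:(lra)). cbv beta in H'. lra.
      * intros s Hs. specialize (Htr T0 s Hs). lra.
  - left.
    (* Never near an unstable point, [xi] is trapped by a stable point soon after any [t0], however
       early. Points obtained from different [t0] agree because both are near [xi] at a common late
       time. *)
    assert (Hlate : forall t0, exists p, limit_set d phi p /\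
      forall t, t0 + T <= t -> d p (xi t) < e).
    { intros t0. destruct (Hstep t0) as (p & t & Lp & Sp & Ht & Hp); [eauto|].
      exists p. split; [assumption|]. intros s Hs.
      destruct (Htrap p Lp xi Hxi (t0 + t) ltac:(lra)) as [H' _]. apply H'; [assumption|lra]. }
    destruct (Hlate 0) as (p & Lp & Hp). exists p. split; [assumption|]. intros t.
    destruct (Hlate (t - T)) as (p' & Lp' & Hp').
    pose proof (Rmax_l t (0 + T)). pose proof (Rmax_r t (0 + T)).
    assert (p = p') as <-.
    { apply (Hsame _ _ (xi (Rmax t (0 + T)))); try assumption; [apply Hp|apply Hp']; lra. }
    specialize (Hp' t ltac:(lra)). lra.
Qed.

End Transition.

(** * Construction and gluing of reparametrizations *)

Lemma increasing_surjective_Rep (h : R -> R) :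
  (forall s t, s < t -> h s < h t) -> (forall y, exists x, h x = y) -> Rep h.
Proof.
  intros Hinc Hsurj. split; [assumption|]. split; [assumption|].
  assert (Hrev : forall s t, h s < h t -> s < t).
  { intros s t Hst. apply Rnot_le_lt. intros [Hts|Hts]; [apply Hinc in Hts; lra|].
    subst. lra. }
  intros t eps He.
  (* Continuity comes from surjectivity: preimages of [h t - eps / 2] and [h t + eps / 2] bracket
     [t]. *)
  destruct (Hsurj (h t - eps / 2)) as [u Hu]. destruct (Hsurj (h t + eps / 2)) as [v Hv].
  assert (u < t) by (apply Hrev; lra). assert (t < v) by (apply Hrev; lra).
  exists (Rmin (t - u) (v - t)). split; [apply Rmin_pos; lra|].
  intros s [_ Hs]. pose proof (Rmin_l (t - u) (v - t)). pose proof (Rmin_r (t - u) (v - t)).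
  cbn in *. unfold R_dist in *. apply Rabs_def2 in Hs.
  assert (h u < h s) by (apply Hinc; lra). assert (h s < h v) by (apply Hinc; lra).
  apply Rabs_def1; lra.
Qed.

Lemma affine_Rep (a b k : R) : 0 < k -> Rep (fun t => b + k * (t - a)).
Proof.
  intros Hk. apply increasing_surjective_Rep.
  - intros s t Hst. apply Rplus_lt_compat_l, Rmult_lt_compat_l; lra.
  - intros y. exists (a + (y - b) / k). field. lra.
Qed.

Lemma Rep_le (h : R -> R) (s t : R) : Rep h -> s <= t -> h s <= h t.
Proof. intros [H _] Hst. destruct Hst as [Hst| ->]; [specialize (H s t Hst)|]; lra. Qed.

Lemma Rep_reflects_le (h : R -> R) (s t : R) : Rep h -> h s <= h t -> s <= t.
Proof. intros [H _] Hst. apply Rnot_lt_le. intros L. apply H in L. lra. Qed.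

Definition glue (a : R) (f g : R -> R) (t : R) : R :=
  if Rle_dec t a then f t else g t.

Lemma glue_left (a : R) (f g : R -> R) (t : R) : t <= a -> glue a f g t = f t.
Proof. intros H. unfold glue. destruct (Rle_dec t a); [reflexivity|lra]. Qed.

Lemma glue_right (a : R) (f g : R -> R) (t : R) :
  f a = g a -> a <= t -> glue a f g t = g t.
Proof.
  intros E H. unfold glue. destruct (Rle_dec t a); [|reflexivity].
  now replace t with a by lra.
Qed.

Lemma glue_Rep (a : R) (f g : R -> R) : Rep f -> Rep g -> f a = g a -> Rep (glue a f g).
Proof.
  intros Hf Hg E. apply increasing_surjective_Rep.
  - intros s t Hst. unfold glue. destruct (Rle_dec s a), (Rle_dec t a).
    + now apply Hf.
    + pose proof (Rep_le f s a Hf ltac:(lra)).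
      pose proof (proj1 Hg a t ltac:(lra)). lra.
    + lra.
    + now apply Hg.
  - intros y. destruct (Rle_dec y (f a)) as [L|L].
    + destruct (proj1 (proj2 Hf) y) as [x <-]. exists x. apply glue_left.
      now apply (Rep_reflects_le f).
    + destruct (proj1 (proj2 Hg) y) as [x <-]. exists x. apply glue_right; [assumption|].
      apply (Rep_reflects_le g); [assumption|lra].
Qed.

(* Slope one on [T0, T0 + N], then affine until it rejoins [h] at [t1]. *)
Lemma Rep_unit_slope (h : R -> R) (T0 N t1 : R) :
  Rep h -> 0 < N -> T0 + N < t1 -> h T0 + N < h t1 ->
  exists g, Rep g /\ (forall t, t <= T0 -> g t = h t) /\ (forall t, t1 <= t -> g t = h t) /\
    forall t, T0 <= t <= T0 + N -> g t = h T0 + (t - T0).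
Proof.
  intros Hh HN Ht1 Hht1.
  pose (k := (h t1 - h T0 - N) / (t1 - T0 - N)).
  assert (Hk : 0 < k) by (apply Rdiv_lt_0_compat; lra).
  pose (f1 := fun t => h T0 + 1 * (t - T0)).
  pose (f2 := fun t => (h T0 + N) + k * (t - (T0 + N))).
  assert (E1 : f2 t1 = h t1) by (unfold f2, k; field; lra).
  pose (g1 := glue t1 f2 h).
  assert (G1 : Rep g1) by (apply glue_Rep; [now apply affine_Rep|assumption|assumption]).
  assert (E2 : f1 (T0 + N) = g1 (T0 + N)).
  { unfold g1. rewrite glue_left by lra. unfold f1, f2. ring. }
  pose (g2 := glue (T0 + N) f1 g1).
  assert (G2 : Rep g2) by (apply glue_Rep; [apply affine_Rep; lra|assumption|assumption]).
  assert (E3 : h T0 = g2 T0).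
  { unfold g2. rewrite glue_left by lra. unfold f1. ring. }
  exists (glue T0 h g2). split; [|split; [|split]].
  - now apply glue_Rep.
  - intros t Ht. now apply glue_left.
  - intros t Ht. rewrite glue_right by (assumption || lra). unfold g2.
    rewrite glue_right by (assumption || lra). apply glue_right; assumption || lra.
  - intros t Ht. rewrite glue_right by (assumption || lra). unfold g2.
    rewrite glue_left by lra. unfold f1. ring.
Qed.

(** * Shadowing with almost unit speed on a window *)

Section UnitSpeed.
Context {M : Type} (d : M -> M -> R) (phi : R -> M -> M).
Hypothesis dm : is_metric d.
Hypothesis cpt : metric_compact d.
Hypothesis fl : is_flow d phi.

(** A period [s <= tau] would confine the whole orbit to [phi v x] with [0 <= v <= s], all closer
    than [c] to [x], against the displacement at time [t]. *)
Lemma not_periodic_below (x : M) (t c tau : R) :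
  (forall s y, Rabs s <= tau -> d y (phi s y) < c) -> c <= d x (phi t x) ->
  forall s, 0 < s <= tau -> phi s x <> x.
Proof.
  intros Hsmall Hx s Hs E.
  assert (Hn : forall n, phi (INR n * s) x = x).
  { induction n as [|n IH].
    - rewrite Rmult_0_l. apply (flow_zero d phi fl).
    - rewrite S_INR, Rmult_plus_distr_r, Rmult_1_l, <- (flow_add d phi fl). now rewrite E. }
  assert (Hpos : forall u, 0 <= u -> exists v, 0 <= v <= s /\ phi u x = phi v x).
  { assert (H : forall n u, 0 <= u <= INR n * s ->
      exists v, 0 <= v <= s /\ phi u x = phi v x).
    { induction n as [|n IH]; intros u Hu.
      - exists u. cbn in Hu. split; [lra|reflexivity].
      - rewrite S_INR in Hu. destruct (Rle_dec u (INR n * s)) as [L|L]; [apply IH; lra|].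
        exists (u - INR n * s). split; [lra|]. rewrite <- (Hn n) at 2.
        rewrite (flow_add d phi fl). f_equal. ring. }
    intros u Hu. destruct (INR_unbounded (u / s)) as [n Hgt]. apply (H n). split; [assumption|].
    apply (Rmult_lt_compat_r s) in Hgt; [|lra].
    unfold Rdiv in Hgt. rewrite Rmult_assoc, Rinv_l in Hgt by lra. lra. }
  (* [t] may be negative; adding a multiple of the period makes it nonnegative. *)
  destruct (INR_unbounded (- t / s)) as [n Hgt].
  apply (Rmult_lt_compat_r s) in Hgt; [|lra].
  unfold Rdiv in Hgt. rewrite Rmult_assoc, Rinv_l in Hgt by lra.
  destruct (Hpos (t + INR n * s) ltac:(lra)) as (v & Hv & Ev).
  rewrite <- (flow_add d phi fl), Hn in Ev. rewrite Ev in Hx.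
  specialize (Hsmall v x). rewrite Rabs_pos_eq in Hsmall by lra. specialize (Hsmall ltac:(lra)).
  lra.
Qed.

(** Compactness is used twice: first for a common bound [c] below which no point away from the
    singularities has a period, then, with [tau <= c] fixed, for a common lower bound on the
    displacement at time [tau]. *)
Lemma no_short_periods (r eta : R) : 0 < r -> 0 < eta ->
  exists tau e, 0 < tau <= eta /\ 0 < e /\
    forall y, (forall p, singular phi p -> r <= d p y) -> e <= d y (phi tau y).
Proof.
  intros Hr Heta.
  pose (far y := forall p, singular phi p -> r <= d p y).
  (* The complement of [far] is open, so around its points both local claims are vacuous; only
     nonsingular points remain. *)
  assert (Hfar : forall x, (exists c, 0 < c /\ forall y, d x y < c -> ~ far y) \/
    ~ singular phi x /\ far x).
  { intros x. destruct (classic (far x)) as [Hx|Hx].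
    - right. split; [|assumption]. intros Sx. specialize (Hx x Sx).
      rewrite (metric_refl d dm) in Hx. lra.
    - left. apply not_all_ex_not in Hx. destruct Hx as [p Hp].
      apply imply_to_and in Hp. destruct Hp as [Sp Hp].
      exists (r - d p x). split; [lra|]. intros y Hy Hf. specialize (Hf p Sp).
      pose proof (metric_tri d dm p x y). lra. }
  destruct (compact_uniform_radius d dm cpt (fun y c =>
    far y -> forall s, 0 < s <= c -> phi s y <> y)) as (c & Hc & Hper).
  { intros y c c' H [? ?] Hy s Hs. apply H; [assumption|lra]. }
  { intros x. destruct (Hfar x) as [(c & Hc & H)|[Sx _]].
    - exists c, 1. split; [assumption|]. split; [lra|]. intros y Hy Hf.
      now destruct (H y Hy).
    - apply not_all_ex_not in Sx. destruct Sx as [t Ht].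
      assert (Hd : 0 < d x (phi t x)) by (apply metric_pos; auto).
      (* One third is lost at each end on passing from [x] to a nearby [y], and one third of the
         displacement remains. *)
      set (b := d x (phi t x) / 3).
      destruct (flow_continuous d phi fl t x b) as (a & Ha & Hcont); [unfold b; lra|].
      destruct (small_time d phi dm cpt fl b) as (tau & Htau & Hsmall); [unfold b; lra|].
      assert (0 < b) by (unfold b; lra).
      exists (Rmin a b), tau. split; [now apply Rmin_pos|]. split; [assumption|].
      intros y Hy _. apply (not_periodic_below y t b tau); [auto|].
      pose proof (Rmin_l a b). pose proof (Rmin_r a b). specialize (Hcont y ltac:(lra)).
      pose proof (metric_tri d dm x y (phi t x)).
      pose proof (metric_tri d dm y (phi t y) (phi t x)).
      rewrite (metric_sym d dm (phi t x)) in Hcont.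
      assert (d x (phi t x) = 3 * b) by (unfold b; lra). lra. }
  set (tau := Rmin c eta).
  assert (Htau : 0 < tau <= eta) by (split; [now apply Rmin_pos|apply Rmin_r]).
  assert (tau <= c) by apply Rmin_l.
  destruct (compact_uniform_radius d dm cpt (fun y e => far y -> e <= d y (phi tau y)))
    as (e & He & H').
  { intros y e e' H' [? ?] Hy. specialize (H' Hy). lra. }
  { intros x. destruct (Hfar x) as [(a & Ha & H')|[_ Hx]].
    - exists a, 1. split; [assumption|]. split; [lra|]. intros y Hy Hf.
      now destruct (H' y Hy).
    - assert (Hd : 0 < d x (phi tau x)).
      { apply metric_pos; [assumption|]. apply not_eq_sym, Hper; [assumption|lra]. }
      set (b := d x (phi tau x) / 3). assert (Hb : 0 < b) by (unfold b; lra).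
      destruct (flow_continuous d phi fl tau x b Hb) as (a & Ha & Hcont).
      exists (Rmin a b), b. split; [now apply Rmin_pos|]. split; [assumption|].
      intros y Hy _.
      pose proof (Rmin_l a b). pose proof (Rmin_r a b). specialize (Hcont y ltac:(lra)).
      pose proof (metric_tri d dm x y (phi tau x)).
      pose proof (metric_tri d dm y (phi tau y) (phi tau x)).
      rewrite (metric_sym d dm (phi tau x)) in Hcont.
      assert (d x (phi tau x) = 3 * b) by (unfold b; lra). lra. }
  exists tau, e. auto.
Qed.

Lemma flow_near_singularity (T eps : R) : 0 < eps ->
  exists c, 0 < c /\ forall p x t, singular phi p -> d p x < c -> 0 <= t <= T ->
    d p (phi t x) < eps.
Proof.
  intros He. destruct (flow_equicontinuous d phi dm cpt fl T eps He) as (c & Hc & H).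
  exists c. split; [assumption|]. intros p x t Sp Hx Ht.
  specialize (H t p x Ht Hx). now rewrite (Sp t) in H.
Qed.

(** An orbit that gets close to a singularity within time [T] must have started close to it, by
    equicontinuity of the reversed flow. *)
Lemma flow_far_from_singularities (T r : R) : 0 < r ->
  exists c, 0 < c /\ forall p x t, singular phi p -> r <= d p x -> 0 <= t <= T ->
    c <= d p (phi t x).
Proof.
  intros Hr.
  destruct (flow_equicontinuous d (reverse_flow phi) dm cpt (reverse_is_flow d phi fl) T r Hr)
    as (c & Hc & H).
  exists c. split; [assumption|]. intros p x t Sp Hx Ht. apply Rnot_lt_le. intros L.
  specialize (H t _ _ Ht L). unfold reverse_flow in H.
  rewrite (Sp (- t)), (flow_add d phi fl), Rplus_opp_l, (flow_zero d phi fl) in H. lra.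
Qed.

(* If [h] drifted from unit speed, then by the intermediate value theorem the drift
   would equal [tau] or [- tau] at some time, making the orbit almost [tau]-periodic. *)
Lemma drift_bounded (h : R -> R) (z : M) (T0 N tau e : R) :
  Rep h -> 0 < tau ->
  (forall s, 0 <= s <= N -> e <= d (phi s z) (phi tau (phi s z))) ->
  (forall s, 0 <= s <= N -> d (phi s z) (phi (h (T0 + s) - h T0) z) < e) ->
  forall t, T0 <= t <= T0 + N -> Rabs (h t - h T0 - (t - T0)) <= tau.
Proof.
  intros Hh Htau Hfar Hnear t Ht.
  pose (u s := h s - h T0 - (s - T0)).
  assert (Hu : continuity u).
  { apply continuity_minus; [apply continuity_minus|apply continuity_minus].
    - exact (proj2 (proj2 Hh)).
    - apply continuity_const. now intros ? ?.
    - apply derivable_continuous, derivable_id.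
    - apply continuity_const. now intros ? ?. }
  assert (Hu0 : u T0 = 0) by (unfold u; ring).
  assert (Hmiss : forall s, T0 <= s <= T0 + N -> u s <> tau /\ u s <> - tau).
  { intros s Hs. specialize (Hnear (s - T0) ltac:(lra)).
    replace (T0 + (s - T0)) with s in Hnear by ring.
    (* For drift [- tau] the displacement bound is applied at [h s - h T0], which monotonicity of
       [h] keeps inside [[0, N]]. *)
    pose proof (Rep_le h T0 s Hh ltac:(lra)) as Hmon.
    split; intros E; unfold u in E.
    - specialize (Hfar (s - T0) ltac:(lra)). rewrite (flow_add d phi fl) in Hfar.
      replace (tau + (s - T0)) with (h s - h T0) in Hfar by lra. lra.
    - specialize (Hfar (h s - h T0) ltac:(lra)). rewrite (flow_add d phi fl) in Hfar.
      replace (tau + (h s - h T0)) with (s - T0) in Hfar by lra.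
      rewrite (metric_sym d dm) in Hfar. lra. }
  apply Rnot_lt_le. intros L. fold (u t) in L.
  assert (t <> T0) by (intros ->; rewrite Hu0, Rabs_R0 in L; lra).
  unfold Rabs in L. destruct (Rcase_abs (u t)) as [Hneg|Hpos].
  - destruct (IVT (fun s => - u s - tau) T0 t) as (s & Hs & Es); cbv beta; try lra.
    + apply continuity_minus; [now apply continuity_opp|].
      apply continuity_const. now intros ? ?.
    + destruct (Hmiss s ltac:(lra)) as [_ H']. lra.
  - destruct (IVT (fun s => u s - tau) T0 t) as (s & Hs & Es); cbv beta; try lra.
    + apply continuity_minus; [assumption|].
      apply continuity_const. now intros ? ?.
    + destruct (Hmiss s ltac:(lra)) as [H' _]. lra.
Qed.

(** While both curves stay [eps / 2]-close to [p], they are [eps]-close under any matching of times,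
    so [h] may be replaced there by a map of unit slope that rejoins it later. The rejoining time
    must be late for both clocks, [t] and [h t], hence the disjunction. *)
Lemma reparametrize_near_point (xi : R -> M) (x p : M) (h : R -> R) (T0 N eps : R) :
  Rep h -> 0 < N ->
  (forall t, d (xi t) (phi (h t) x) < eps) ->
  (forall t, T0 <= t -> t <= T0 + N + 1 \/ h t <= h T0 + N + 1 ->
    d p (xi t) < eps / 2 /\ d p (phi (h t) x) < eps / 2) ->
  exists g, Rep g /\ (forall t, d (xi t) (phi (g t) x) < eps) /\
    forall t, T0 <= t <= T0 + N -> g t - g T0 - (t - T0) = 0.
Proof.
  intros Hh HN Hshadow Hnear.
  destruct (proj1 (proj2 Hh) (h T0 + N + 1)) as [tb Htb].
  set (t1 := Rmax tb (T0 + N + 1)).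
  assert (Hb : tb <= t1) by apply Rmax_l. assert (HN1 : T0 + N + 1 <= t1) by apply Rmax_r.
  pose proof (Rep_le h tb t1 Hh Hb) as Hhb.
  destruct (Rep_unit_slope h T0 N t1 Hh HN ltac:(lra) ltac:(lra))
    as (g & Hg & Hleft & Hright & Hslope).
  assert (Hwindow : forall t, T0 <= t <= t1 ->
    d p (xi t) < eps / 2 /\ d p (phi (h t) x) < eps / 2).
  { intros t Ht. apply Hnear; [lra|]. destruct (Rle_dec t (T0 + N + 1)) as [L|L]; [now left|].
    right. rewrite <- Htb. apply Rep_le; [assumption|]. unfold t1, Rmax in Ht.
    destruct (Rle_dec tb (T0 + N + 1)); lra. }
  exists g. split; [assumption|]. split.
  - intros t. destruct (Rle_dec t T0) as [L|L]; [now rewrite Hleft|].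
    (* Since [g] and [h] agree at [T0] and [t1], each [g t] in between is some [h s] with [s] in the
       same interval. *)
    destruct (Rle_dec t1 t) as [R|R]; [now rewrite Hright|].
    destruct (proj1 (proj2 Hh) (g t)) as [s Hs].
    assert (T0 <= s).
    { apply (Rep_reflects_le h); [assumption|]. rewrite Hs, <- (Hleft T0) by lra.
      apply Rep_le; [assumption|lra]. }
    assert (s <= t1).
    { apply (Rep_reflects_le h); [assumption|]. rewrite Hs, <- (Hright t1) by lra.
      apply Rep_le; [assumption|lra]. }
    rewrite <- Hs. destruct (Hwindow t ltac:(lra)) as [Hxi _].
    destruct (Hwindow s ltac:(lra)) as [_ Hx].
    pose proof (metric_tri d dm (xi t) p (phi (h s) x)).
    rewrite (metric_sym d dm (xi t) p) in *. lra.
  - intros t Ht. rewrite (Hleft T0), (Hslope t Ht) by lra. ring.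
Qed.

Lemma shadowing_with_unit_speed (eps N eta : R) :
  oriented_shadowing d phi -> 0 < eps -> 0 < N -> 0 < eta ->
  exists c, 0 < c /\ forall xi, pseudotrajectory d phi c xi -> forall T0,
    exists x h, Rep h /\ (forall t, d (xi t) (phi (h t) x) < eps) /\
      forall t, T0 <= t <= T0 + N -> Rabs (h t - h T0 - (t - T0)) <= eta.
Proof.
  intros Hsh He HN Heta.
  destruct (flow_near_singularity (N + 1) (eps / 4)) as (r & Hr & Hnear); [lra|].
  destruct (flow_far_from_singularities N (r / 4)) as (r' & Hr' & Hfar); [lra|].
  destruct (no_short_periods r' eta Hr' Heta) as (tau & e & Htau & He' & Hper).
  destruct (flow_equicontinuous d phi dm cpt fl N (e / 3)) as (a & Ha & Hequi); [lra|].
  (* [r / 4] carries the threshold [r / 2] from [xi T0] over to [z] in both cases. [eps / 8] serves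
     the case near a singularity; [e / 3] and [a] make three errors add up to [e] in the other
     case. *)
  set (e1 := Rmin (Rmin (r / 4) (eps / 8)) (Rmin (e / 3) a)).
  assert (He1 : 0 < e1) by (repeat apply Rmin_pos; lra).
  assert (e1 <= r / 4 /\ e1 <= eps / 8 /\ e1 <= e / 3 /\ e1 <= a) as (L1 & L2 & L3 & L4).
  { unfold e1. pose proof (Rmin_l (Rmin (r / 4) (eps / 8)) (Rmin (e / 3) a)).
    pose proof (Rmin_r (Rmin (r / 4) (eps / 8)) (Rmin (e / 3) a)).
    pose proof (Rmin_l (r / 4) (eps / 8)). pose proof (Rmin_r (r / 4) (eps / 8)).
    pose proof (Rmin_l (e / 3) a). pose proof (Rmin_r (e / 3) a). lra. }
  destruct (Hsh e1 He1) as (c1 & Hc1 & Hshadow).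
  destruct (pseudotrajectory_tracks d phi dm cpt fl (N + 1) e1 He1) as (c2 & Hc2 & Htrack).
  exists (Rmin c1 c2). split; [now apply Rmin_pos|]. intros xi Hxi T0.
  specialize (Htrack xi (pseudotrajectory_weaken d phi _ _ xi (Rmin_r _ _) Hxi)).
  destruct (Hshadow xi (pseudotrajectory_weaken d phi _ _ xi (Rmin_l _ _) Hxi))
    as (x & h & Hh & Hx).
  set (z := phi (h T0) x).
  assert (Hz : forall t, phi (h t) x = phi (h t - h T0) z).
  { intros t. unfold z. rewrite (flow_add d phi fl). f_equal. ring. }
  pose proof (Hx T0) as Hz0. fold z in Hz0.
  destruct (classic (exists p, singular phi p /\ d p (xi T0) < r / 2)) as [(p & Sp & Hp)|Hno].
  - destruct (reparametrize_near_point xi x p h T0 N eps Hh HN) as (g & Hg & Hgx & Hslope).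
    + intros t. specialize (Hx t). lra.
    + intros t Ht Hor. specialize (Hx t).
      pose proof (metric_tri d dm p (xi t) (phi (h t) x)).
      pose proof (metric_tri d dm p (phi (h t) x) (xi t)).
      pose proof (metric_sym d dm (xi t) (phi (h t) x)).
      (* The two curves are [eps / 8]-close at time [t], so it suffices to bound one: [xi] through
         the orbit of [xi T0], or the shadowing orbit through [z]. *)
      enough (d p (xi t) < eps * 3 / 8 \/ d p (phi (h t) x) < eps / 4) by lra.
      destruct Hor as [Hor|Hor].
      * left. specialize (Htrack T0 (t - T0) ltac:(lra)).
        replace (T0 + (t - T0)) with t in Htrack by ring.
        specialize (Hnear p (xi T0) (t - T0) Sp ltac:(lra) ltac:(lra)).
        pose proof (metric_tri d dm p (phi (t - T0) (xi T0)) (xi t)).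
        rewrite (metric_sym d dm (xi t)) in Htrack. lra.
      * right. rewrite Hz. pose proof (Rep_le h T0 t Hh Ht).
        pose proof (metric_tri d dm p (xi T0) z). apply Hnear; [assumption|lra|lra].
    + exists x, g. split; [assumption|]. split; [assumption|].
      intros t Ht. rewrite (Hslope t Ht), Rabs_R0. lra.
  - exists x, h. split; [assumption|]. split; [intros t; specialize (Hx t); lra|].
    intros t Ht. apply Rle_trans with tau; [|lra].
    apply (drift_bounded h z T0 N tau e); try assumption; [lra| |].
    + intros s Hs. apply Hper. intros p Sp. apply Hfar; [assumption| |assumption].
      apply Rnot_lt_le. intros L. apply Hno. exists p. split; [assumption|].
      pose proof (metric_tri d dm p z (xi T0)). rewrite (metric_sym d dm z (xi T0)) in *. lra.
    + intros s Hs. rewrite <- Hz.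
      specialize (Htrack T0 s ltac:(lra)). specialize (Hx (T0 + s)).
      specialize (Hequi s z (xi T0) Hs). rewrite (metric_sym d dm z) in Hequi.
      specialize (Hequi ltac:(lra)).
      pose proof (metric_tri d dm (phi s z) (phi s (xi T0)) (phi (h (T0 + s)) x)).
      pose proof (metric_tri d dm (phi s (xi T0)) (xi (T0 + s)) (phi (h (T0 + s)) x)).
      rewrite (metric_sym d dm (xi (T0 + s)) (phi s (xi T0))) in Htrack. lra.
Qed.

End UnitSpeed.

(** * Shadowing in the product flow *)

Theorem theorem1p2 (M1 M2 : Type) (d1 : M1 -> M1 -> R) (d2 : M2 -> M2 -> R)
  (phi1 : R -> M1 -> M1) (phi2 : R -> M2 -> M2) :
  is_metric d1 -> metric_compact d1 ->
  is_metric d2 -> metric_compact d2 ->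
  is_flow d1 phi1 -> is_flow d2 phi2 ->
  oriented_shadowing d1 phi1 ->
  finite_set (singular phi1) ->
  finite_set (limit_set d2 phi2) ->
  (forall p, limit_set d2 phi2 p ->
     singular phi2 p /\ (lyapunov_stable d2 phi2 p \/ lyapunov_unstable d2 phi2 p)) ->
  oriented_shadowing (prod_dist d1 d2) (prod_flow phi1 phi2).
Proof.
  intros dm1 cpt1 dm2 cpt2 fl1 fl2 Hsh _ Hfin Hlim eps He.
  destruct (pseudotrajectory_connects d2 phi2 dm2 cpt2 fl2 Hfin
    (fun p Lp => proj2 (Hlim p Lp)) (eps / 2)) as (c2 & N & Hc2 & HN & Hconn); [lra|].
  destruct (small_time d2 phi2 dm2 cpt2 fl2 (eps / 2)) as (tau & Htau & Hsmall); [lra|].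
  (* Drift at most [tau] moves the [M2] orbit by less than [eps / 2] inside the window; drift at
     most [1] puts it past [N - 1] at the end of the window. *)
  destruct (shadowing_with_unit_speed d1 phi1 dm1 cpt1 fl1 eps N (Rmin tau 1) Hsh He HN)
    as (c1 & Hc1 & Hshadow); [apply Rmin_pos; lra|].
  pose proof (Rmin_l tau 1). pose proof (Rmin_r tau 1).
  exists (Rmin c1 c2). split; [now apply Rmin_pos|]. intros xi Hxi.
  assert (Hxi1 : pseudotrajectory d1 phi1 c1 (fun t => fst (xi t))).
  { intros t s Hs. apply Rlt_le_trans with (Rmin c1 c2); [|apply Rmin_l].
    eapply Rle_lt_trans; [apply Rmax_l|exact (Hxi t s Hs)]. }
  assert (Hxi2 : pseudotrajectory d2 phi2 c2 (fun t => snd (xi t))).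
  { intros t s Hs. apply Rlt_le_trans with (Rmin c1 c2); [|apply Rmin_r].
    eapply Rle_lt_trans; [apply Rmax_r|exact (Hxi t s Hs)]. }
  destruct (Hconn _ Hxi2) as [(p & Lp & Hp)|(q & p & T0 & Hq & Hp & Hq' & Hp' & Hmid)].
  (* The second component is the fixed point [p], so any [h] and any window will do. *)
  - destruct (Hshadow _ Hxi1 0) as (x & h & Hh & Hx & _).
    exists (x, p), h. split; [assumption|]. intros t. apply Rmax_lub_lt; [apply Hx|].
    cbn. rewrite (proj1 (Hlim p Lp)), (metric_sym d2 dm2). specialize (Hp t). lra.
  - cbv beta in *. destruct (Hshadow _ Hxi1 T0) as (x & h & Hh & Hx & Hspeed).
    set (w := snd (xi T0)) in *.
    (* The second component is chosen to pass through [w] at time [h T0], that is, when [xi] is at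
       [T0]. *)
    exists (x, phi2 (- h T0) w), h. split; [assumption|]. intros t.
    apply Rmax_lub_lt; [apply Hx|]. cbn. rewrite (flow_add d2 phi2 fl2).
    set (u := h t + - h T0).
    destruct (Rle_dec t T0) as [L|L]; [|destruct (Rle_dec t (T0 + N)) as [R|R]].
    + pose proof (Rep_le h t T0 Hh L). specialize (Hq t L).
      specialize (Hq' u ltac:(unfold u; lra)).
      pose proof (metric_tri d2 dm2 (snd (xi t)) q (phi2 u w)).
      rewrite (metric_sym d2 dm2 (snd (xi t)) q) in *. lra.
    + specialize (Hspeed t ltac:(lra)). specialize (Hmid (t - T0) ltac:(lra)).
      replace (T0 + (t - T0)) with t in Hmid by ring.
      set (v := h t - h T0 - (t - T0)) in *.
      specialize (Hsmall v (phi2 (t - T0) w) ltac:(lra)).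
      rewrite (flow_add d2 phi2 fl2) in Hsmall.
      replace (v + (t - T0)) with u in Hsmall by (unfold u, v; ring).
      pose proof (metric_tri d2 dm2 (snd (xi t)) (phi2 (t - T0) w) (phi2 u w)). lra.
    + specialize (Hspeed (T0 + N) ltac:(lra)).
      pose proof (Rep_le h (T0 + N) t Hh ltac:(lra)).
      pose proof (Rle_abs (- (h (T0 + N) - h T0 - (T0 + N - T0)))) as Habs.
      rewrite Rabs_Ropp in Habs.
      specialize (Hp t ltac:(lra)). specialize (Hp' u ltac:(unfold u; lra)).
      pose proof (metric_tri d2 dm2 (snd (xi t)) p (phi2 u w)).
      rewrite (metric_sym d2 dm2 (snd (xi t)) p) in *. lra.
Qed.
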